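(* Let $p$ be a prime and let $T\subset\mathbb{Q}_p$ be a non-empty locally finite set. Then $T$ corresponds to a uniform partition of unity if and only if there exists an integer $n$ such that \[\#\big(B(x,p^n)\cap T\big)=\#\big(B(y,p^n)\cap T\big)\quad\text{for all }x,y\in\mathbb{Q}_p.\]
   Context: $\mathbb{Q}_p$ is the field of $p$-adic numbers with Haar measure normalized so that $\mathbb{Z}_p$ has measure $1$; $B(x,p^n)=\{y\in\mathbb{Q}_p:|x-y|_p\le p^n\}$. A set $T$ is locally finite if its intersection with every compact set is finite. $T$ is said to correspond to a uniform partition of unity if there exists a non-negative function $f\in L^1(\mathbb{Q}_p)$ such that $\sum_{t\in T} f(x-t)=1$ for a.e. $x\in\mathbb{Q}_p$. *)

(* Defs.v *)
From HB Require Import structures.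
From mathcomp Require Import all_boot all_order all_algebra.
From mathcomp Require Import all_classical all_reals all_analysis.
Set Implicit Arguments. Unset Strict Implicit. Unset Printing Implicit Defensive.
Import Order.TTheory GRing.Theory Num.Theory.
Local Open Scope ring_scope.
Local Open Scope classical_set_scope.

(* A concrete model of the additive (topological) group Q_p.                 *)
(* An element x of Q_p is encoded by the sequence of its residues            *)
(*     r_k = x mod p^k Z_p  (k : nat),                                       *)
(* each represented by its canonical representative in Z[1/p] /\ [0, p^k):   *)
(* a rational with a p-power denominator in [0, p^k), and the sequence must  *)
(* be compatible: r_(k+1) - r_k is an integer multiple of p^k.  This is the  *)
(* standard identification Q_p = lim_k Q_p/p^k Z_p = lim_k Z[1/p]/p^k Z.     *)
(* As for 'Z_p in MathComp we use pp p := maxn p 2 as the modulus, so the     *)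
(* type is meaningful for every p and equals the usual one when p is prime.  *)

Definition pp (p : nat) : nat := maxn p 2.

Definition pfrac (p : nat) (q : rat) : bool := (pp p).-nat `|denq q|%N.

Definition isint (q : rat) : bool := denq q == 1.

Definition canon (p k : nat) (q : rat) : bool :=
  [&& pfrac p q, 0 <= q & q < ((pp p) ^ k)%:R].

Definition qp_seq (p : nat) (r : nat -> rat) : Prop :=
  forall k, canon p k (r k) && isint ((r k.+1 - r k) / ((pp p) ^ k)%:R).

Record Qp (p : nat) := MkQp { res : nat -> rat ; resP : qp_seq p res }.

HB.instance Definition _ p := gen_eqMixin (Qp p).
HB.instance Definition _ p := gen_choiceMixin (Qp p).

Lemma qp_seq0 p : qp_seq p (fun _ => 0).
Proof.
move=> k; rewrite /canon /pfrac /isint subrr mul0r.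
have -> : denq 0 = 1 by [].
rewrite eqxx lexx /= ltr0n expn_gt0 /pp leq_max orbT.
by [].
Qed.

Definition qp0 p : Qp p := MkQp (@qp_seq0 p).

HB.instance Definition _ p := isPointed.Build (Qp p) (qp0 p).

Definition modq (q m : rat) : rat := q - (Num.floor (q / m))%:~R * m.

Definition raw_sub p (x y : Qp p) : nat -> rat :=
  fun k => modq (res x k - res y k) ((pp p) ^ k)%:R.

(* subtraction x - y in Q_p (the fallback branch is never taken, since the  *)
(* residue sequence of x - y always satisfies qp_seq)                        *)
Definition qp_sub p (x y : Qp p) : Qp p :=
  match pselect (qp_seq p (raw_sub x y)) with
  | left h => MkQp h
  | right _ => x
  end.

(* z (given by its residue sequence) lies in p^m Z_p, i.e. |z|_p <= p^(-m) *)
Definition in_pZ (p : nat) (m : int) (z : nat -> rat) : Prop :=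
  forall k, isint (z k / ((pp p)%:R ^ m)).

(* B(x, p^n) = { y | |x - y|_p <= p^n } = { y | x - y \in p^(-n) Z_p } *)
Definition ballp p (x : Qp p) (n : int) : set (Qp p) :=
  [set y | in_pZ p (- n) (raw_sub x y)].

Definition Zp p : set (Qp p) := ballp (qp0 p) 0.

Definition openp p (U : set (Qp p)) : Prop :=
  forall x, U x -> exists n : int, ballp x n `<=` U.

Definition compactp p (K : set (Qp p)) : Prop :=
  forall (I : Type) (U : I -> set (Qp p)), (forall i, openp (U i)) ->
    K `<=` \bigcup_i U i ->
    exists F : set I, finite_set F /\ K `<=` \bigcup_(i in F) U i.

Definition locally_finite p (T : set (Qp p)) : Prop :=
  forall K, compactp K -> finite_set (K `&` T).

(* Borel sigma-algebra of Q_p: generated by the (countably many) balls *)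
Definition balls p : set (set (Qp p)) :=
  [set B | exists (x : Qp p) (n : int), B = ballp x n].

Definition QpM p := g_sigma_algebraType (@balls p).

(* Haar measure normalized by mu(Z_p) = 1: a translation invariant Borel   *)
(* measure with mu(Z_p) = 1 (such a measure is unique).                     *)
Definition haar_normalized (R : realType) p
  (mu : {measure set (QpM p) -> \bar R}) : Prop :=
  mu (@Zp p) = 1%E /\
  forall (a : QpM p) (A : set (QpM p)), measurable A ->
    mu ((fun y => qp_sub y a) @^-1` A) = mu A.

Definition uniform_pou (R : realType) p
  (mu : {measure set (QpM p) -> \bar R}) (T : set (QpM p)) : Prop :=
  exists f : QpM p -> R,
    (forall x, 0 <= f x) /\ mu.-integrable setT (EFin \o f) /\
    {ae mu, forall x : QpM p, (\esum_(t in T) (f (qp_sub x t))%:E = 1)%E}.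

(* Main.v *)
(* Write N(x) for the number of points of T in the ball B(x, p^n). Integrating
   sum_t f(y - t) = 1 over y in B(x, p^n) and exchanging sum and integral gives
     int f(y) N(x - y) dy = mu(B(0, p^n))   for every x.
   Take n so large that f has more mass in B(0, p^n) than outside it, and call
   these masses a > s. Since N(x - y) = N(x) for y in B(0, p^n), the identity
   first shows that N is bounded; if M and m are its maximum and minimum, then
   taking x where they are attained gives
     M a + m s <= mu(B(0, p^n)) <= m a + M s,
   so M = m. Conversely, if N is constant, then f = 1_{B(0, p^n)} / N works. *)

Require Import Defs.
From HB Require Import structures.
From mathcomp Require Import all_boot all_order all_algebra.
From mathcomp Require Import all_classical all_reals all_analysis.
From mathcomp Require Import finmap measurable_realfun zify ring lra.
Set Implicit Arguments.
Unset Strict Implicit.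
Unset Printing Implicit Defensive.
Import Order.TTheory GRing.Theory Num.Theory.
Local Open Scope ring_scope.
Local Open Scope classical_set_scope.
Local Open Scope card_scope.

(** * Residues and balls *)

Section Residues.
Variable p : nat.
Implicit Types (q r : rat) (m n : int) (k j : nat) (x y z t : Qp p).

(** Since [m] may be negative, divisibility by [p^m] is taken inside the rationals. Ball membership
    reduces to such a divisibility between residues. *)
Definition pmult m q : bool := q / (pp p)%:R ^ m \is a Num.int.

Lemma pp_gt0 : (0 < pp p)%N. Proof. by rewrite /pp leq_max orbT. Qed.

Lemma ppR_gt0 : 0 < (pp p)%:R :> rat. Proof. by rewrite ltr0n pp_gt0. Qed.

Lemma ppR_neq0 : (pp p)%:R != 0 :> rat. Proof. by rewrite gt_eqF ?ppR_gt0. Qed.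

Lemma pmultD m q r : pmult m q -> pmult m r -> pmult m (q + r).
Proof. by rewrite /pmult mulrDl; exact: rpredD. Qed.

Lemma pmultN m q : pmult m (- q) = pmult m q.
Proof. by rewrite /pmult mulNr rpredN. Qed.

Lemma pmultB m q r : pmult m q -> pmult m r -> pmult m (q - r).
Proof. by move=> hq hr; apply: pmultD; rewrite ?pmultN. Qed.

Lemma pmult_eqmod m q r : pmult m (q - r) -> pmult m q = pmult m r.
Proof.
move=> h; apply/idP/idP => [hq|hr].
  by rewrite -(subKr q r); apply: pmultB.
by rewrite -(subrK r q); apply: pmultD.
Qed.

Lemma pmultW m n q : m <= n -> pmult n q -> pmult m q.
Proof.
move=> mn; rewrite /pmult => h.
have -> : q / (pp p)%:R ^ m = q / (pp p)%:R ^ n * (pp p)%:R ^ (n - m).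
  by rewrite expfzDr ?ppR_neq0// -invr_expz; field; rewrite !expfz_neq0 ?ppR_neq0.
apply: rpredM => //.
by rewrite -[n - m]gez0_abs ?subr_ge0//; apply: rpredX; exact: rpred_nat.
Qed.

Lemma pmult_nat k q : pmult k q = (q / ((pp p) ^ k)%:R \is a Num.int).
Proof. by rewrite /pmult natrX. Qed.

(** A nonzero multiple of [p^k] has absolute value at least [p^k]; hence congruent residues in
    [[0, p^k)] coincide. *)
Lemma pmult_small k q : pmult k q -> `|q| < ((pp p) ^ k)%:R -> q = 0.
Proof.
rewrite pmult_nat => /(@intrP rat)[i hi] hq.
have p0 : 0 < ((pp p) ^ k)%:R :> rat by rewrite ltr0n expn_gt0 pp_gt0.
have qE : q = i%:~R * ((pp p) ^ k)%:R by rewrite -hi mulfVK ?gt_eqF.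
move: hq; rewrite qE normrM (gtr0_norm p0) gtr_pMl// -intr_norm -[1]/(1%:~R).
rewrite ltr_int => hi1; suff -> : i = 0 by rewrite mul0r.
by lia.
Qed.

Lemma modq_congr k q : pmult k (modq q ((pp p) ^ k)%:R - q).
Proof.
rewrite /modq addrAC subrr add0r pmultN pmult_nat mulfK ?intr_int//.
  by rewrite pnatr_eq0 expn_eq0 negb_and -lt0n pp_gt0.
Qed.

Lemma modq_itv k q : 0 <= modq q ((pp p) ^ k)%:R < ((pp p) ^ k)%:R.
Proof.
have p0 : 0 < ((pp p) ^ k)%:R :> rat by rewrite ltr0n expn_gt0 pp_gt0.
have /andP[h1 h2] := floor_itv (q / ((pp p) ^ k)%:R).
rewrite /modq subr_ge0 -ler_pdivlMr// h1 /= ltrBlDl.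
by move: h2; rewrite ltr_pdivrMr// intrD mulrDl mul1r.
Qed.

Lemma res_itv x k : 0 <= res x k < ((pp p) ^ k)%:R.
Proof. by have /andP[/and3P[_ -> ->]] := resP x k. Qed.

Lemma res_congr x k j : (k <= j)%N -> pmult k (res x j - res x k).
Proof.
move=> /subnKC <-; elim: (j - k)%N => [|i IH].
  by rewrite addn0 subrr pmult_nat mul0r.
rewrite addnS -[res x _.+1](subrK (res x (k + i))) -addrA; apply: pmultD => //.
have /andP[_ h] := resP x (k + i); apply: (@pmultW _ (k + i)%N); first by lia.
by rewrite pmult_nat.
Qed.

Lemma res_congrW x k j m : m <= k%:Z -> m <= j%:Z -> pmult m (res x j - res x k).
Proof.
move=> mk mj; have [kj|/ltnW jk] := leqP k j.
  exact: pmultW mk (res_congr x kj).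
by rewrite -opprB pmultN; exact: pmultW mj (res_congr x jk).
Qed.

Lemma res_inj x y : res x =1 res y -> x = y.
Proof.
case: x y => [a ha] [b hb] /= /funext ab; subst b.
by congr MkQp; exact: Prop_irrelevance.
Qed.

(** One fine enough level decides membership: the residues of a point at levels at least [- n] agree
    modulo [p^(-n)], and at coarser levels the reduced difference is then zero. *)
Lemma ballpE x y n k : - n <= k%:Z ->
  ballp x n y <-> pmult (- n) (res x k - res y k).
Proof.
move=> nk; split => [/(_ k) h|h j].
  rewrite -(@pmult_eqmod _ (raw_sub x y k))//.
  exact: pmultW nk (modq_congr _ _).
have [nj|jn] := leP (- n) j%:Z.
  change (pmult (- n) (raw_sub x y j)).
  rewrite (@pmult_eqmod _ _ (res x j - res y j)); last first.
    exact: pmultW nj (modq_congr _ _).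
  rewrite (@pmult_eqmod _ (res x j - _) (res x k - res y k))//.
  have -> : res x j - res y j - (res x k - res y k) =
    (res x j - res x k) - (res y j - res y k) by ring.
  by apply: pmultB; apply: res_congrW.
(* Here [j < - n]: the reduced difference lies in [[0, p^j)] and is a multiple of [p^j]. *)
suff -> : raw_sub x y j = 0 by rewrite mul0r.
apply: (@pmult_small j); last first.
  by have /andP[h1 h2] := modq_itv j (res x j - res y j); rewrite ger0_norm.
rewrite (@pmult_eqmod _ _ (res x j - res y j)); last exact: modq_congr.
rewrite (@pmult_eqmod _ (res x j - _) (res x k - res y k)); last first.
  have -> : res x j - res y j - (res x k - res y k) =
    (res x j - res x k) - (res y j - res y k) by ring.
  by apply: pmultB; apply: res_congrW => //; lia.
exact: pmultW (ltW jn) h.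
Qed.

Lemma res_ballp x y n k : - n <= k%:Z -> res x k = res y k -> ballp x n y.
Proof.
by move=> nk xy; apply/(ballpE _ _ nk); rewrite xy subrr /pmult mul0r.
Qed.

Lemma ballp_refl x n : ballp x n x.
Proof. by apply: (@res_ballp _ _ _ `|n|%N) => //; lia. Qed.

Lemma ballp_sym x y n : ballp x n y -> ballp y n x.
Proof.
have nk : - n <= `|n|%N%:Z by lia.
by move=> /(ballpE _ _ nk) h; apply/(ballpE _ _ nk); rewrite -opprB pmultN.
Qed.

Lemma ballp_trans x y z n : ballp x n y -> ballp y n z -> ballp x n z.
Proof.
have nk : - n <= `|n|%N%:Z by lia.
move=> /(ballpE _ _ nk) h1 /(ballpE _ _ nk) h2; apply/(ballpE _ _ nk).
by rewrite -(subrK (res y `|n|) (res x `|n|)) -addrA; apply: pmultD.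
Qed.

Lemma ballp_eq x y n : ballp x n y -> ballp x n = ballp y n.
Proof.
move=> xy; apply/seteqP; split => z; last exact: ballp_trans.
exact/ballp_trans/ballp_sym.
Qed.

Lemma ballpW x m n : m <= n -> ballp x m `<=` ballp x n.
Proof.
move=> mn y; have mk : - m <= `|m|%N%:Z by lia.
have nk : - n <= `|m|%N%:Z by lia.
move=> /(ballpE _ _ mk) h; apply/(ballpE _ _ nk).
by apply: pmultW h; rewrite lerN2.
Qed.

(** * Subtraction for prime [p] and its action on balls *)

Hypothesis hp : prime p.

Lemma pp_prime : pp p = p.
Proof. by rewrite /pp; apply/maxn_idPl; exact: prime_gt1. Qed.

(** This form makes closure under sums easy. Conversely, [numq q * p^j = i * denq q] and coprimality
    force [denq q] to divide [p^j]. *)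
Lemma pfracP q : pfrac p q <-> exists j, q * ((pp p) ^ j)%:R \is a Num.int.
Proof.
rewrite /pfrac !pp_prime; split.
  move=> /p_natP[j hj]; exists j.
  rewrite -hj natr_absz gtr0_norm ?denq_gt0// -{1}[q]divq_num_den.
  by rewrite mulfVK ?intq_eq0 ?denq_neq0//; exact: intr_int.
move=> [j /(@intrP rat)[i hi]].
have pj : (p%:R ^+ j != 0 :> rat) by rewrite expf_neq0// pnatr_eq0 -lt0n prime_gt0.
apply: (@pnat_dvd _ (p ^ j)); last by rewrite pnatX pnat_id.
suff : (denq q %| (p ^ j)%N%:Z)%Z by [].
have : (numq q * (p ^ j)%N%:Z)%:~R = (i * denq q)%:~R :> rat.
  by rewrite !intrM -hi numqE -pmulrn; ring.
move=> /intr_inj e.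
have : (denq q %| numq q * (p ^ j)%N%:Z)%Z by rewrite e; exact: dvdz_mull.
by rewrite Gauss_dvdzr// /coprimez /gcdz eqz_nat gcdnC; exact: coprime_num_den.
Qed.

Lemma pfracD q r : pfrac p q -> pfrac p r -> pfrac p (q + r).
Proof.
move=> /pfracP[i hi] /pfracP[j hj]; apply/pfracP; exists (i + j)%N.
have -> : (q + r) * (pp p ^ (i + j))%:R =
  q * (pp p ^ i)%:R * (pp p ^ j)%:R + r * (pp p ^ j)%:R * (pp p ^ i)%:R.
  by rewrite expnD natrM; ring.
by apply: rpredD; apply: rpredM => //; exact: rpred_nat.
Qed.

Lemma pfracN q : pfrac p (- q) = pfrac p q.
Proof. by rewrite /pfrac denqN. Qed.

Lemma pfrac_int (i : int) : pfrac p i%:~R.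
Proof. by apply/pfracP; exists 0; rewrite expn0 mulr1; exact: intr_int. Qed.

Lemma pfrac_nat (k : nat) : pfrac p k%:R.
Proof. exact: (pfrac_int k). Qed.

Lemma pfracM_int q (i : int) : pfrac p q -> pfrac p (i%:~R * q).
Proof.
move=> /pfracP[j hj]; apply/pfracP; exists j; rewrite -mulrA.
by apply: rpredM => //; exact: intr_int.
Qed.

(** This rules out the fallback branch of [qp_sub]. Reduction changes the differences at levels [k]
    and [k.+1] by multiples of [p^k], and the unreduced ones are compatible because [x] and [y]
    are. *)
Lemma raw_sub_qp_seq x y : qp_seq p (raw_sub x y).
Proof.
move=> k; apply/andP; split.
  have /andP[h0 h1] := modq_itv k (res x k - res y k).
  apply/and3P; split => //; rewrite /raw_sub /modq.
  have /andP[/and3P[hx _ _] _] := resP x k.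
  have /andP[/and3P[hy _ _] _] := resP y k.
  by rewrite !pfracD ?pfracN// pfracM_int// pfrac_nat.
change (is_true ((raw_sub x y k.+1 - raw_sub x y k)
  / (pp p ^ k)%:R \is a Num.int)).
rewrite -pmult_nat.
have -> : raw_sub x y k.+1 - raw_sub x y k =
  (raw_sub x y k.+1 - (res x k.+1 - res y k.+1)) -
  (raw_sub x y k - (res x k - res y k)) +
  ((res x k.+1 - res x k) - (res y k.+1 - res y k)) by ring.
apply: pmultD; last by apply: pmultB; exact: res_congr.
apply: pmultB; last exact: modq_congr.
by apply: (@pmultW _ k.+1%:Z); [lia | exact: modq_congr].
Qed.

Lemma res_qp_sub x y k : res (qp_sub x y) k = raw_sub x y k.
Proof.
by rewrite /qp_sub; case: pselect => //; have := raw_sub_qp_seq x y.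
Qed.

Lemma res_qp_sub_congr x y k : pmult k (res (qp_sub x y) k - (res x k - res y k)).
Proof. by rewrite res_qp_sub; exact: modq_congr. Qed.

(** The translation rules for balls below all follow from this by a ring identity between
    residues. *)
Lemma ballp_sub2 x y z t n :
  let k := `|n|%N in
  ballp (qp_sub x y) n (qp_sub z t) <->
  pmult (- n) (res x k - res y k - (res z k - res t k)).
Proof.
move=> k; have nk : - n <= k%:Z by rewrite /k; lia.
rewrite (ballpE _ _ nk).
rewrite (@pmult_eqmod _ _ (res x k - res y k - (res z k - res t k)))//.
set a := res x k - _; set b := res z k - _.
have -> : res (qp_sub x y) k - res (qp_sub z t) k - (a - b) =
  (res (qp_sub x y) k - a) - (res (qp_sub z t) k - b) by ring.
by apply: pmultW nk _; apply: pmultB; exact: res_qp_sub_congr.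
Qed.

(** Both residues lie in [[0, p^k)] and are congruent modulo [p^k]. The lemma also serves to write a
    point as a difference, so that [ballp_sub2] applies. *)
Lemma qp_sub0 x : qp_sub x (qp0 p) = x.
Proof.
apply: res_inj => k; apply/eqP; rewrite -subr_eq0; apply/eqP.
apply: (@pmult_small k).
  by have := res_qp_sub_congr x (qp0 p) k; rewrite /= subr0.
have /andP[? ?] := res_itv x k; have /andP[? ?] := res_itv (qp_sub x (qp0 p)) k.
by rewrite ltr_norml; apply/andP; split; lra.
Qed.

Lemma ballp_subr x y t n : ballp (qp_sub x t) n (qp_sub y t) <-> ballp x n y.
Proof.
rewrite ballp_sub2 (@ballpE _ _ _ `|n|%N); last by lia.
by have -> : forall a b c : rat, a - c - (b - c) = a - b by move=> a b c; ring.
Qed.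

Lemma ballp_subC x y t n : ballp (qp_sub x t) n y <-> ballp (qp_sub x y) n t.
Proof.
rewrite -{1}(qp_sub0 y) -{2}(qp_sub0 t) !ballp_sub2 /= !subr0.
by have -> : forall a b c : rat, a - b - c = a - c - b by move=> a b c; ring.
Qed.

Lemma ballp_sub_ball0 x t n : ballp (qp0 p) n (qp_sub x t) <-> ballp x n t.
Proof.
rewrite -{1}(qp_sub0 (qp0 p)) ballp_sub2 (@ballpE _ _ _ `|n|%N); last by lia.
rewrite /= -[X in pmult _ X <-> _]opprK pmultN.
by have -> : forall a b : rat, - (0 - 0 - (a - b)) = a - b by move=> a b; ring.
Qed.

Lemma ballp_sub_small x y n : ballp (qp0 p) n y -> ballp (qp_sub x y) n = ballp x n.
Proof.
move=> /ballp_sym y0; apply: ballp_eq; rewrite -{2}(qp_sub0 x).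
apply/ballp_sub2; move: y0; rewrite (@ballpE _ _ _ `|n|%N); last by lia.
rewrite -pmultN /=.
by have -> : forall a b : rat, a - b - (a - 0) = - (b - 0) by move=> a b; ring.
Qed.

(** The residue at level 0 is the fractional part of [x]; a power [p^j] clearing its denominator
    bounds [|x|_p]. *)
Lemma ballp_cover x : exists n : nat, ballp (qp0 p) n x.
Proof.
have /andP[/and3P[/pfracP[j hj] _ _] _] := resP x 0.
exists j; apply/(@ballpE _ _ _ 0); first by lia.
by rewrite /= sub0r pmultN /pmult -invr_expz invrK -exprnP -natrX.
Qed.

End Residues.

(** * Compactness of balls *)

Section Compactness.
Variable p : nat.
Implicit Types (m n : int) (k : nat) (x y z t : Qp p).

Lemma openp_ballp x n : openp (ballp x n).
Proof. by move=> y xy; exists n; rewrite (ballp_eq xy). Qed.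

Lemma finite_set_int_bounded (b : nat) : finite_set [set i : int | `|i| <= b%:Z].
Proof.
apply: (@sub_finite_set _ _ ((fun j : nat => j%:Z - b%:Z) @` `I_(b + b).+1)).
  by move=> i /= hi; exists (absz (i + b%:Z)); lia.
by apply: finite_image; exact: finite_II.
Qed.

Lemma finite_set_res_ballp x n k : finite_set ((fun y => res y k) @` ballp x n).
Proof.
(* Enlarging the ball makes level [k] fine enough to decide membership. *)
wlog nk : n / - n <= k%:Z.
  move=> /(_ (Order.max n (- k%:Z))) h; have {}h := h ltac:(lia).
  by apply: sub_finite_set h; apply/image_subset/ballpW; lia.
set P := (pp p)%:R ^ (- n) : rat.
have P0 : 0 < P by rewrite exprz_gt0// ppR_gt0.
(* The residues have the form [res x k - i * p^(-n)]; as both residues lie in [[0, p^k)], [|i|] is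
   at most [p^(k+n)]. *)
have finI := finite_set_int_bounded ((pp p) ^ absz (k%:Z + n)).
apply: sub_finite_set (finite_image (fun i : int => res x k - i%:~R * P) finI).
move=> _ [y /(ballpE _ _ nk) /(@intrP rat)[i hi] <-]; exists i => /=; last first.
  by rewrite -hi mulfVK ?gt_eqF// opprB addrC subrK.
rewrite -(ler_int rat) intr_norm -hi normrM normfV (gtr0_norm P0) ler_pdivrMr//.
have -> : ((pp p) ^ absz (k%:Z + n)%R)%N%:Z%:~R * P = ((pp p) ^ k)%:R :> rat.
  rewrite -pmulrn !natrX !exprnP -expfzDr ?ppR_neq0//; congr (_ ^ _); lia.
have /andP[? ?] := res_itv x k; have /andP[? ?] := res_itv y k.
by rewrite ler_norml; apply/andP; split; lra.
Qed.

Section FiniteSubcover.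
Context (I : Type) (U : I -> set (Qp p)).

Definition fin_covered (C : set (Qp p)) : Prop :=
  exists F : set I, finite_set F /\ C `<=` \bigcup_(i in F) U i.

Lemma fin_covered_bigcup (J : Type) (D : set J) (C : J -> set (Qp p)) :
  finite_set D -> (forall j, D j -> fin_covered (C j)) ->
  fin_covered (\bigcup_(j in D) C j).
Proof.
move=> finD h.
have /choice[F hF] : forall j, exists F,
    D j -> finite_set F /\ C j `<=` \bigcup_(i in F) U i.
  move=> j; have [/h[F hF]|nD] := pselect (D j); first by exists F.
  by exists set0.
exists (\bigcup_(j in D) F j); split.
  by apply: bigcup_finite => // j /hF[].
move=> y [j Dj Cy]; have [_ /(_ _ Cy)[i Fi Uy]] := hF j Dj.
by exists i => //; exists j.
Qed.

End FiniteSubcover.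

(* Konig's lemma on the tree of residues: if no finite subfamily covers, then
   residues can be fixed one level at a time so that the points of the ball with
   these residues are never finitely covered; the chosen residues define a point
   whose open neighbourhood in the cover yields a contradiction. *)
Lemma compactp_ballp x n : compactp (ballp x n).
Proof.
move=> I U oU xU; apply: contrapT => ncov.
pose C k y := ballp x n `&` [set z | res z k = res y k].
have step k (A : set (Qp p)) : A `<=` ballp x n -> ~ fin_covered U A ->
    exists y, ~ fin_covered U (A `&` [set z | res z k = res y k]).
  move=> Ax nA; apply: contrapT => /forallNP h; apply: nA.
  have -> : A = \bigcup_(q in (fun y => res y k) @` A) (A `&` [set z | res z k = q]).
    apply/seteqP; split => [y Ay|y [q _ []//]].
    by exists (res y k) => //; exists y.
  apply: fin_covered_bigcup => [|_ [y Ay <-]]; last exact: contrapT (h y).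
  by apply: sub_finite_set (finite_set_res_ballp x n k); exact: image_subset.
have next : forall ky : nat * Qp p, exists y', ~ fin_covered U (C ky.1 ky.2) ->
    ~ fin_covered U (C ky.1.+1 y') /\ res y' ky.1 = res ky.2 ky.1.
  move=> [k y] /=; have [h|h] := pselect (fin_covered U (C k y)).
    by exists y => /(_ h).
  have [|y' hy'] := step k.+1 (C k y) _ h; first by move=> ? [].
  (* An empty cell would be covered by the empty family, so the cell has a point [w]; unlike [y'],
     it is known to agree with [y] at level [k]. *)
  have [[w [[xw wy] wy']]|nw] :=
    pselect (C k y `&` [set z | res z k.+1 = res y' k.+1] !=set0); last first.
    exfalso; apply: hy'; exists set0; split => // w hw.
    by exfalso; apply: nw; exists w.
  exists w => _; split => // -[F [finF hF]]; apply: hy'; exists F; split => //.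
  by move=> z [[xz zy] zy']; apply: hF; split => //; rewrite /= zy' wy'.
have [f hf] := choice next.
have [y0 hy0] := step 0%N (ballp x n) (fun _ => id) ncov.
pose F := fix F k := if k is k'.+1 then f (k', F k') else y0.
have hF k : ~ fin_covered U (C k (F k)).
  by elim: k => //= k IH; have [] := hf (k, F k) IH.
have FS k : res (F k.+1) k = res (F k) k by have [] := hf (k, F k) (hF k).
(* The diagonal residues are compatible because [F k.+1] and [F k] agree at level [k]. *)
have seqF : qp_seq p (fun k => res (F k) k).
  move=> k; have /andP[-> _] := resP (F k) k; rewrite -(FS k).
  by have /andP[_ ->] := resP (F k.+1) k.
pose z := MkQp seqF.
have xz : ballp x n z.
  have [[w [xw wF]]|nw] := pselect (C `|n|%N (F `|n|%N) !=set0).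
    by apply: ballp_trans xw _; apply: (@res_ballp _ _ _ _ `|n|%N) => //; lia.
  exfalso; apply: (hF `|n|%N); exists set0; split => // w hw.
  by exfalso; apply: nw; exists w.
have [i _ Uz] := xU _ xz; have [m zm] := oU i _ Uz.
(* Points of this cell share with [z] the residue at level [|m|], hence lie in [ballp z m], so [U i]
   alone covers the cell. *)
apply: (hF `|m|%N); exists [set i]; split; first exact: finite_set1.
move=> w [_ wF]; exists i => //; apply: zm.
by apply: (@res_ballp _ _ _ _ `|m|%N) => //; lia.
Qed.

End Compactness.

(** * Integration *)

Section CountableSums.
Local Open Scope ereal_scope.
Context d (X : measurableType d) (R : realType) (I : pointedType).
Variables (A : set I) (g : I -> X -> \bar R) (D : set X).
Hypotheses (cA : countable A) (mg : forall i, measurable_fun D (g i)).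
Hypothesis g0 : forall i x, 0 <= g i x.

(** The enumeration is chosen before [a], so one series serves every point [x] at once; [None] pads
    with zero terms. *)
Lemma esum_countable_nneseries : exists e : nat -> option I,
  forall a : I -> \bar R, (forall i, 0 <= a i) ->
  \esum_(i in A) a i = \sum_(0 <= k <oo) (if e k is Some i then a i else 0).
Proof.
have /countable_bijP[B] := cA; rewrite card_eq_sym => /pcard_eqP[e].
exists (fun k => if k \in B then Some (e k) else None) => a a0.
rewrite (reindex_esum B A e); last exact: bij.
rewrite esum_mkcond -nneseries_esumT; last by move=> k; case: ifP.
by apply: eq_eseriesr => k _; case: ifP.
Qed.

Lemma measurable_fun_esum : measurable_fun D (fun x => \esum_(i in A) g i x).
Proof.
have [e he] := esum_countable_nneseries.
under eq_fun do rewrite he//.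
apply: (@ge0_emeasurable_sum _ _ _ D
  (fun k x => if e k is Some i then g i x else 0) xpredT) => [k x _ _|k _].
  by case: (e k).
by case: (e k) => [i|]; [exact: mg|exact: measurable_cst].
Qed.

Lemma ge0_integral_esum (mu : {measure set X -> \bar R}) : measurable D ->
  \int[mu]_(x in D) (\esum_(i in A) g i x) =
  \esum_(i in A) \int[mu]_(x in D) g i x.
Proof.
move=> mD; have [e he] := esum_countable_nneseries.
under eq_integral do rewrite he//.
rewrite he; last by move=> i; exact: integral_ge0.
rewrite integral_nneseries//.
- apply: eq_eseriesr => k _; case: (e k) => // .
  exact: integral0.
- by move=> k; case: (e k) => [i|]; [exact: mg|exact: measurable_cst].
- by move=> k x _; case: (e k).
Qed.

End CountableSums.

(** * Haar measure: translations and balls *)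

Section Haar.
Context (R : realType) (p : nat).
Hypothesis hp : prime p.
Implicit Types (x y z t : QpM p) (n : int).

Lemma measurable_ballp x n : measurable (ballp x n : set (QpM p)).
Proof. by apply: sub_sigma_algebra; exists x, n. Qed.

Lemma preimage_qp_sub_ballp x t n :
  (fun y => qp_sub y t) @^-1` ballp (qp_sub x t) n = ballp x n.
Proof. by apply/seteqP; split => y /= /(ballp_subr hp). Qed.

Lemma measurable_qp_sub t :
  measurable_fun [set: QpM p] (fun y : QpM p => qp_sub y t : QpM p).
Proof.
apply: (@measurability _ _ (QpM p) (QpM p) setT _ (@balls p)) => //.
move=> _ [_ [x [n ->]] <-].
rewrite setTI.
(* On the generating balls: a non-empty preimage is the ball of the same radius around any of its
   points. *)
have [[y0 hy0]|/set0P/negP/negPn/eqP ->//] :=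
  pselect ((fun y : QpM p => qp_sub y t) @^-1` ballp x n !=set0).
rewrite (ballp_eq hy0) preimage_qp_sub_ballp; exact: measurable_ballp.
Qed.

Section Measure.
Variable mu : {measure set (QpM p) -> \bar R}.
Hypothesis hmu : haar_normalized mu.

Lemma haar_ballp x n : mu (ballp x n) = mu (ballp (qp0 p) n).
Proof.
rewrite -(preimage_qp_sub_ballp x x) (hmu.2 x)//; last exact: measurable_ballp.
congr (mu _); apply/esym/ballp_eq; apply/(ballp_sub_ball0 hp); exact: ballp_refl.
Qed.

(** By compactness, finitely many balls of radius 1 cover the ball, and each has measure 1. *)
Lemma haar_ballp_fin x n : (mu (ballp x n) < +oo)%E.
Proof.
have [||F [finF hF]] := @compactp_ballp p x n (QpM p) (fun y => ballp y 0).
- by move=> y; exact: openp_ballp.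
- by move=> y _; exists y => //; exact: ballp_refl.
apply: (@le_lt_trans _ _ (\sum_(y \in F) mu (ballp y 0))%E).
  by apply: content_sub_fsum => // [y _|]; exact: measurable_ballp.
rewrite fsbig_finite//=; apply/lte_sum_pinfty => y _.
by rewrite haar_ballp [mu _]hmu.1 ltry.
Qed.

(** Invariance says that the pushforward of [mu] under translation by [t] is [mu] itself. *)
Lemma haar_integral_qp_sub t (D : set (QpM p)) (g : QpM p -> \bar R) :
  measurable D -> measurable_fun D g -> (forall y, (0 <= g y)%E) ->
  (\int[mu]_(y in (fun y => qp_sub y t) @^-1` D) g (qp_sub y t) =
   \int[mu]_(y in D) g y)%E.
Proof.
move=> mD mg g0.
have /= <- := ge0_integral_pushforward (measurable_qp_sub t) mu mD mg
  (fun y _ => g0 y).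
apply: eq_measure_integral => [|mphi A mA _]; first exact: measurable_qp_sub.
exact: hmu.2.
Qed.

End Measure.

(** * Counting the points of [T] in balls *)

Section Counting.
Variable T : set (QpM p).
Hypothesis Tlf : locally_finite T.

Definition ball_count n x : nat := #|` fset_set (ballp x n `&` T)|.

Lemma finite_ballpI x n : finite_set (ballp x n `&` T).
Proof. exact/Tlf/compactp_ballp. Qed.

Lemma locally_finite_countable : countable T.
Proof.
have -> : T = \bigcup_(k : nat) (ballp (qp0 p) k `&` T).
  apply/seteqP; split => [t Tt|t [k _ []//]].
  by have [k hk] := ballp_cover hp t; exists k.
apply: bigcup_countable => // k _; exact/finite_set_countable/finite_ballpI.
Qed.

Lemma esum_ballp (c : R) x n : 0 <= c ->
  \esum_(t in T) (c * \1_(ballp x n) t)%:E = (c * (ball_count n x)%:R)%:E.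
Proof.
move=> c0.
have -> : \esum_(t in T) (c * \1_(ballp x n) t)%:E =
    \esum_(t in ballp x n `&` T) c%:E.
  rewrite setIC esum_mkcondr; apply: eq_esum => t _.
  by rewrite indicE; case: ifP => _; rewrite ?mulr1 ?mulr0.
rewrite esum_fset//; last exact: finite_ballpI.
rewrite fsbig_finite//=; last exact: finite_ballpI.
rewrite sumEFin /ball_count -sum1_size natr_sum mulr_sumr.
by under [in RHS]eq_bigr do rewrite mulr1.
Qed.

Lemma ball_count_sub_small x y n : ballp (qp0 p) n y ->
  ball_count n (qp_sub x y) = ball_count n x.
Proof. by move=> y0; rewrite /ball_count (ballp_sub_small hp x y0). Qed.

End Counting.
End Haar.

(** * Partitions of unity *)

Lemma eq_indic (R : realType) (X Y : Type) (A : set X) (B : set Y) a b :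
  (A a <-> B b) -> \1_A a = \1_B b :> R.
Proof.
by move=> AB; rewrite !indicE; congr (_%:R); congr nat_of_bool; apply/idP/idP;
  move=> /set_mem/AB/mem_set.
Qed.

Section PartitionOfUnity.
Context (R : realType) (p : nat).
Hypothesis hp : prime p.
Variable mu : {measure set (QpM p) -> \bar R}.
Hypothesis hmu : haar_normalized mu.
Variable T : set (QpM p).
Hypothesis Tlf : locally_finite T.
Implicit Types (x y z t : QpM p) (n : int).

Lemma const_ball_count_pou n : T !=set0 ->
  (forall x y, ball_count T n x = ball_count T n y) -> uniform_pou mu T.
Proof.
move=> [t0 Tt0] Nconst; set c := ball_count T n t0.
(* The point [t0] of [T] lies in its own ball, so the common count is positive. *)
have c0 : c%:R != 0 :> R.
  rewrite pnatr_eq0 -lt0n cardfs_gt0; apply/fset0Pn; exists t0.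
  rewrite in_fset_set; last exact: finite_ballpI.
  by apply/mem_set; split => //; exact: ballp_refl.
have mB := measurable_ballp (qp0 p) n.
exists (fun x => c%:R^-1 * \1_(ballp (qp0 p) n) x); split; [|split].
- by move=> x; rewrite mulr_ge0 ?invr_ge0// indicE.
- apply/integrableP; split.
    by apply/measurable_EFinP; apply: measurable_funM => //; exact: measurable_indic.
  under eq_integral => x _.
    rewrite /= ger0_norm ?mulr_ge0 ?invr_ge0 ?indicE// EFinM -indicE.
    over.
  have c'0 : (0 <= (c%:R^-1)%:E :> \bar R)%E by rewrite lee_fin invr_ge0.
  have i0 (x : QpM p) : setT x -> (0 <= (\1_(ballp (qp0 p) n) x)%:E :> \bar R)%E.
    by rewrite lee_fin indicE.
  have mi : measurable_fun setT
      (fun x : QpM p => (\1_(ballp (qp0 p) n) x)%:E : \bar R).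
    by apply/measurable_EFinP; exact: measurable_indic.
  rewrite (ge0_integralZl mu measurableT mi i0 c'0).
  rewrite integral_indic// setIT lte_mul_pinfty ?lee_fin ?invr_ge0//.
  exact: haar_ballp_fin.
- apply: aeW => x.
  (* Since [x - t] is in the ball around 0 exactly when [t] is in [ballp x n], the sum counts points
     of [T] near [x]. *)
  rewrite (_ : \esum_(t in T) _ = \esum_(t in T) (c%:R^-1 * \1_(ballp x n) t)%:E).
    by rewrite esum_ballp ?invr_ge0// (Nconst x t0) mulVf.
  apply: eq_esum => t _; congr (_ * _)%:E.
  exact/eq_indic/ballp_sub_ball0.
Qed.

(** * From a partition of unity to a constant count *)

Section Necessity.
Variable f : QpM p -> R.
Hypothesis f0 : forall x, 0 <= f x.
Hypothesis intf : mu.-integrable setT (EFin \o f).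
Hypothesis sumf :
  {ae mu, forall x : QpM p, (\esum_(t in T) (f (qp_sub x t))%:E = 1)%E}.

Let mf : measurable_fun setT (EFin \o f).
Proof. exact: measurable_int intf. Qed.

Let mfindic n x t : measurable_fun setT
  (fun y => (f y * \1_(ballp (qp_sub x t) n) y)%:E).
Proof.
apply/measurable_EFinP; apply: measurable_funM; first exact/measurable_EFinP.
by apply: measurable_indic; exact: measurable_ballp.
Qed.

(** [y] is near [x - t] exactly when [t] is near [x - y], so summing over [t] counts points of
    [T]. *)
Lemma esum_indic_ballp n x y :
  \esum_(t in T) (f y * \1_(ballp (qp_sub x t) n) y)%:E =
  (f y * (ball_count T n (qp_sub x y))%:R)%:E.
Proof.
rewrite -esum_ballp//; apply: eq_esum => t _; congr (_ * _)%:E.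
exact/eq_indic/ballp_subC.
Qed.

Lemma measurable_fun_ball_count n x :
  measurable_fun setT (fun y => (f y * (ball_count T n (qp_sub x y))%:R)%:E).
Proof.
under eq_fun do rewrite -esum_indic_ballp.
apply: measurable_fun_esum.
- exact: locally_finite_countable.
- by move=> t; exact: mfindic.
- by move=> t y; rewrite lee_fin mulr_ge0// indicE.
Qed.

Lemma integral_ball_count n x :
  (\int[mu]_y (f y * (ball_count T n (qp_sub x y))%:R)%:E = mu (ballp (qp0 p) n))%E.
Proof.
have cT := locally_finite_countable hp Tlf.
have msub t (D : set (QpM p)) :
    measurable_fun D (fun y : QpM p => (f (qp_sub y t))%:E).
  apply: measurable_funTS.
  exact: (measurableT_comp mf (measurable_qp_sub hp t)).
rewrite -(haar_ballp hp hmu x) -[RHS]mul1e -integral_cst;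
  last exact: measurable_ballp.
(* On [ballp x n] the constant 1 is replaced almost everywhere by the sum of the translates of
   [f]. *)
transitivity (\int[mu]_(y in ballp x n) \esum_(t in T) (f (qp_sub y t))%:E)%E;
  last first.
  apply: ge0_ae_eq_integral => //.
  - exact: measurable_ballp.
  - by apply: measurable_fun_esum => // t y; rewrite lee_fin.
  - by move=> y _; apply: esum_ge0 => t _; rewrite lee_fin.
  - by apply: filterS sumf => y ->.
have fsub0 t y : (0 <= (f (qp_sub y t))%:E)%E by rewrite lee_fin.
rewrite (ge0_integral_esum cT (fun t => msub t _) fsub0 mu (measurable_ballp x n)).
under eq_integral do rewrite -esum_indic_ballp.
have findic0 t y : (0 <= (f y * \1_(ballp (qp_sub x t) n) y)%:E)%E.
  by rewrite lee_fin mulr_ge0// indicE.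
rewrite (ge0_integral_esum cT (mfindic n x) findic0)//.
apply: eq_esum => t _.
(* Termwise change of variables: translation by [t] carries [ballp x n] to the ball around
   [x - t]. *)
rewrite -(preimage_qp_sub_ballp hp x t).
have Ef0 y : (0 <= (EFin \o f) y)%E by rewrite lee_fin.
have mfB (D : set (QpM p)) : measurable_fun D (EFin \o f) := measurable_funTS mf.
have /= -> := haar_integral_qp_sub hp hmu t
  (measurable_ballp (qp_sub x t) n) (mfB _) Ef0.
rewrite [RHS]integral_mkcond; apply: eq_integral => y _.
by rewrite patchE indicE; case: ifP => _; rewrite ?mulr1 ?mulr0.
Qed.

(** Otherwise [f] vanishes almost everywhere, and [integral_ball_count] at [n = 0] gives [Zp]
    measure 0 instead of 1. *)
Lemma integral_pou_gt0 : (0 < \int[mu]_y (f y)%:E)%E.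
Proof.
rewrite lt_neqAle integral_ge0 ?andbT; last by move=> y _; rewrite lee_fin.
apply/negP => /eqP I0.
have : (mu (@Defs.Zp p) = 0)%E.
  rewrite -(integral_ball_count 0 (qp0 p)) -(integral0 mu setT).
  apply: ge0_ae_eq_integral => //.
  - exact: measurable_fun_ball_count.
  - by move=> y _; rewrite lee_fin mulr_ge0.
  have : ae_eq mu setT (EFin \o f) (cst 0%E).
    apply/ae_eq_integral_abs => //; rewrite [RHS]I0.
    by apply: eq_integral => y _; rewrite /= ger0_norm.
  by apply: filterS => y /(_ I) [->] _; rewrite mul0r.
by rewrite hmu.1 => /eqP; rewrite onee_eq0.
Qed.

(** If every ball around 0 held at most half of the mass, monotone convergence along these balls
    would bound the total by half of itself, against its finiteness and positivity. *)
Lemma concentrated_ball : exists k : nat,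
  (\int[mu]_(y in ~` ballp (qp0 p) k) (f y)%:E <
   \int[mu]_(y in ballp (qp0 p) k) (f y)%:E)%E.
Proof.
pose F k := ballp (qp0 p) k%:Z : set (QpM p).
have mF k : measurable (F k) := measurable_ballp _ _.
have split_int k : (\int[mu]_y (f y)%:E =
    \int[mu]_(y in F k) (f y)%:E + \int[mu]_(y in ~` F k) (f y)%:E)%E.
  rewrite -ge0_integral_setU ?setUv//; first exact: measurableC.
  - by move=> y _; rewrite lee_fin.
  - by apply/disj_setPCl.
apply: contrapT => /forallNP h.
have intF k : (\int[mu]_(y in F k) (f y)%:E <= 2^-1%:E * \int[mu]_y (f y)%:E)%E.
  rewrite (split_int k).
  have /negP := h k; rewrite -leNgt -/(F k).
  have : (\int[mu]_(y in F k) (f y)%:E \is a fin_num)%E.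
    apply: integrable_fin_num => //; exact: integrableS intf.
  have : (\int[mu]_(y in ~` F k) (f y)%:E \is a fin_num)%E.
    apply: integrable_fin_num; first exact: measurableC.
    by apply: integrableS intf => //; exact: measurableC.
  move=> /fineK <- /fineK <-; rewrite -EFinD -EFinM !lee_fin; lra.
have : (\int[mu]_y (f y)%:E <= 2^-1%:E * \int[mu]_y (f y)%:E)%E.
  have := @ge0_nondecreasing_set_cvg_integral _ _ _ F (EFin \o f) mu.
  have -> : \bigcup_k F k = setT.
    by apply/seteqP; split => // y _; have [k hk] := ballp_cover hp y; exists k.
  move=> cvgF; rewrite -{1}(cvg_lim _ (cvgF _ _ _ _))//.
  - apply: lime_le; last by apply: nearW => k; exact: intF.
    apply/cvg_ex; eexists; apply: cvgF => //.
    + by move=> i j ij; rewrite subsetEset; apply: ballpW; lia.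
    + by move=> i; exact: measurable_funTS.
    + by move=> i y _; rewrite lee_fin.
  - by move=> i j ij; rewrite subsetEset; apply: ballpW; lia.
  - by move=> i; exact: measurable_funTS.
  - by move=> i y _; rewrite lee_fin.
have := integral_pou_gt0.
have /fineK <- : (\int[mu]_y (f y)%:E \is a fin_num)%E by exact: integrable_fin_num.
by rewrite -EFinM lte_fin lee_fin; lra.
Qed.

Lemma pou_const_ball_count : exists n, forall x y,
  ball_count T n x = ball_count T n y.
Proof.
have [k hk] := concentrated_ball; exists k%:Z.
set B := ballp (qp0 p) k in hk.
have mB : measurable (B : set (QpM p)) := measurable_ballp _ _.
have mBC := measurableC mB.
pose N := ball_count T k%:Z.
have fin1 : (\int[mu]_(y in B) (f y)%:E \is a fin_num)%E.
  by apply: integrable_fin_num => //; exact: integrableS intf.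
have fin2 : (\int[mu]_(y in ~` B) (f y)%:E \is a fin_num)%E.
  by apply: integrable_fin_num => //; exact: integrableS intf.
have finV : (mu B \is a fin_num)%E by rewrite ge0_fin_numE//; exact: haar_ballp_fin.
have [a aE] : exists a, (\int[mu]_(y in B) (f y)%:E = a%:E)%E.
  by exists (fine (\int[mu]_(y in B) (f y)%:E)%E); rewrite fineK.
have [s sE] : exists s, (\int[mu]_(y in ~` B) (f y)%:E = s%:E)%E.
  by exists (fine (\int[mu]_(y in ~` B) (f y)%:E)%E); rewrite fineK.
have [v vE] : exists v, (mu B = v%:E)%E by exists (fine (mu B)); rewrite fineK.
have sa : s < a by move: hk; rewrite aE sE lte_fin.
have s0 : 0 <= s.
  by rewrite -lee_fin -sE; apply: integral_ge0 => y _; rewrite lee_fin.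
have mfN x D : measurable_fun D (fun y => (f y * (N (qp_sub x y))%:R)%:E).
  by apply: measurable_funTS; exact: measurable_fun_ball_count.
have mfc (c : nat) D : measurable_fun D (fun y => (f y * c%:R)%:E).
  apply: measurable_funTS; apply/measurable_EFinP/measurable_funM => //.
  exact/measurable_EFinP.
have intfc (c : nat) D : measurable D ->
    (\int[mu]_(y in D) (f y * c%:R)%:E = c%:R%:E * \int[mu]_(y in D) (f y)%:E)%E.
  move=> mD; under eq_integral do rewrite mulrC EFinM.
  rewrite ge0_integralZl ?lee_fin//; first exact: measurable_funTS.
  by move=> y _; rewrite lee_fin.
(* For [y] in [B], [N (x - y) = N x], so this part of the integral is [N x * a]; only the part
   outside [B] stays unevaluated. *)
have V x : (v%:E = ((N x)%:R * a)%:E +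
    \int[mu]_(y in ~` B) (f y * (N (qp_sub x y))%:R)%:E)%E.
  rewrite -vE -(integral_ball_count k x) -(setUv B) ge0_integral_setU//; first last.
  - exact/disj_setPCl.
  - by move=> y _; rewrite lee_fin mulr_ge0.
  congr (_ + _)%E; rewrite EFinM -aE -intfc//; apply: eq_integral => y.
  by move=> /set_mem /(ball_count_sub_small hp T x) ->.
have lo x c : (forall y, c <= N y)%N -> (N x)%:R * a + c%:R * s <= v.
  move=> hc; rewrite -lee_fin (V x) EFinD leeD2l// EFinM -sE -intfc//.
  apply: ge0_le_integral => // y _; rewrite lee_fin.
    by rewrite mulr_ge0.
  by rewrite ler_wpM2l// ler_nat.
have hi x c : (forall y, N y <= c)%N -> v <= (N x)%:R * a + c%:R * s.
  move=> hc; rewrite -lee_fin (V x) EFinD leeD2l// EFinM -sE -intfc//.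
  apply: ge0_le_integral => // y _; rewrite lee_fin.
    by rewrite mulr_ge0.
  by rewrite ler_wpM2l// ler_nat.
pose Q := [pred i : nat | `[< exists x, N x = i >]].
have exQ : exists i, Q i by exists (N (qp0 p)); apply/asboolP; exists (qp0 p).
(* The trivial lower bound [c = 0] in [lo] gives [N x * a <= v], and [a > s >= 0]. *)
have ubQ i : Q i -> (i <= Num.truncn (v / a))%N.
  move=> /asboolP[x <-]; rewrite -ltnS -(ltr_nat R).
  apply: le_lt_trans (truncnS_gt _); rewrite ler_pdivlMr; last by lra.
  by have := lo x 0%N (fun=> leq0n _); rewrite mul0r addr0.
have [M /asboolP[xM NM] Mmax] := ex_maxnP exQ ubQ.
have [m /asboolP[xm Nm] mmin] := ex_minnP exQ.
have Mub y : (N y <= M)%N by apply: Mmax; apply/asboolP; exists y.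
have mlb y : (m <= N y)%N by apply: mmin; apply/asboolP; exists y.
(* Comparing [M a + m s <= v] with [v <= m a + M s] yields [(M - m) (a - s) <= 0]. *)
have Mm : (M <= m)%N.
  rewrite -(ler_nat R).
  have := lo xM m mlb; have := hi xm M Mub; rewrite NM Nm => h1 h2.
  rewrite -subr_le0 -(pmulr_lle0 _ (_ : 0 < a - s)) ?subr_gt0//; lra.
by move=> x y; apply/eqP; rewrite eqn_leq; apply/andP; split;
  [apply: leq_trans (Mub x) (leq_trans Mm (mlb y))
  |apply: leq_trans (Mub y) (leq_trans Mm (mlb x))].
Qed.

End Necessity.
End PartitionOfUnity.

Theorem theorem1p2 (R : realType) (p : nat) (hp : prime p)
  (mu : {measure set (QpM p) -> \bar R}) (hmu : haar_normalized mu)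
  (T : set (QpM p)) (hT0 : T !=set0) (hTlf : locally_finite T) :
  uniform_pou mu T <->
  exists n : int, forall x y : QpM p,
    (ballp x n `&` T) #= (ballp y n `&` T).
Proof.
split=> [[f [f0 [intf sumf]]]|[n hn]].
  have [n hn] := pou_const_ball_count hp hmu hTlf f0 intf sumf.
  by exists n => x y; apply/fcard_eq; [exact: finite_ballpI..|exact: hn].
apply: (const_ball_count_pou hp hmu hTlf (n := n)) => // x y.
by apply/fcard_eq; [exact: finite_ballpI..|exact: hn].
Qed.
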